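(* Let $m\ge2$ and let $S_m=\langle d_1,\dots,d_m\rangle$ be a numerical semigroup minimally generated by $m$ elements. Put $\pi_m=\prod_{i=1}^md_i$, $\sigma_k=\sum_{i=1}^md_i^k$ and $\delta_k=(\sigma_k-1)/2^k$. Then for every $n\ge m$ $$\mathbb{C}_n(S_m)=\frac{(-1)^m\,n!}{(n-m)!}\,\pi_mK_{n-m},$$ where $K_p$ is a linear combination (with a constant term) of the genera $G_0,\dots,G_p$, with coefficients determined by the generators; for $0\le p\le6$ these are: $$K_0=G_0+\delta_1,$$ $$K_1=G_1+\tfrac{\sigma_1}{2}G_0+\tfrac{3\delta_1^2+\delta_2}{6},$$ $$K_2=G_2+\sigma_1G_1+\tfrac{3\sigma_1^2+\sigma_2}{12}G_0+\tfrac{\delta_1(\delta_1^2+\delta_2)}{3},$$ $$K_3=G_3+\tfrac32\sigma_1G_2+\tfrac{3\sigma_1^2+\sigma_2}{4}G_1+\tfrac{\sigma_1(\sigma_1^2+\sigma_2)}{8}G_0+\tfrac{15\delta_1^4+30\delta_1^2\delta_2+5\delta_2^2-2\delta_4}{60},$$ $$K_4=G_4+2\sigma_1G_3+\tfrac{3\sigma_1^2+\sigma_2}{2}G_2+\tfrac{\sigma_1(\sigma_1^2+\sigma_2)}{2}G_1+\tfrac{15\sigma_1^4+30\sigma_1^2\sigma_2+5\sigma_2^2-2\sigma_4}{240}G_0+\delta_1\tfrac{3\delta_1^4+10\delta_1^2\delta_2+5\delta_2^2-2\delta_4}{15},$$ $$K_5=G_5+\tfrac52\sigma_1G_4+\tfrac56(3\sigma_1^2+\sigma_2)G_3+\tfrac54\sigma_1(\sigma_1^2+\sigma_2)G_2+\tfrac{15\sigma_1^4+30\sigma_1^2\sigma_2+5\sigma_2^2-2\sigma_4}{48}G_1+\sigma_1\tfrac{3\sigma_1^4+10\sigma_1^2\sigma_2+5\sigma_2^2-2\sigma_4}{96}G_0+\tfrac{63\delta_1^6+315\delta_1^4\delta_2+315\delta_1^2\delta_2^2-126\delta_1^2\delta_4+35\delta_2^3-42\delta_2\delta_4+16\delta_6}{378},$$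 $$K_6=G_6+3\sigma_1G_5+\tfrac54(3\sigma_1^2+\sigma_2)G_4+\tfrac52\sigma_1(\sigma_1^2+\sigma_2)G_3+\tfrac{15\sigma_1^4+30\sigma_1^2\sigma_2+5\sigma_2^2-2\sigma_4}{16}G_2+\sigma_1\tfrac{3\sigma_1^4+10\sigma_1^2\sigma_2+5\sigma_2^2-2\sigma_4}{16}G_1+\tfrac{63\sigma_1^6+315\sigma_1^4\sigma_2+315\sigma_1^2\sigma_2^2-126\sigma_1^2\sigma_4+35\sigma_2^3-42\sigma_2\sigma_4+16\sigma_6}{4032}G_0+\delta_1\tfrac{9\delta_1^6+63\delta_1^4\delta_2+105\delta_1^2\delta_2^2-42\delta_1^2\delta_4+35\delta_2^3-42\delta_2\delta_4+16\delta_6}{63}.$$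
   Context: A numerical semigroup $S_m=\langle d_1,\dots,d_m\rangle$ is the additive submonoid of $\mathbb{Z}_{\ge 0}$ minimally generated by positive integers $d_1,\dots,d_m$ with $\gcd(d_1,\dots,d_m)=1$. Its genera are $G_r=\sum_{s\in\mathbb{Z}_{>0}\setminus S_m}s^r$, $r\ge0$. The degrees of syzygies $C_{k,j}$ ($1\le k\le m-1$, $1\le j\le\beta_k$) and Betti numbers $\beta_k$ are the degree shifts and ranks of the free modules in the minimal graded free resolution of the semigroup ring of $S_m$ over a polynomial ring in $m$ variables of degrees $d_1,\dots,d_m$, so that $\sum_{s\in S_m}z^s=\bigl(1+\sum_{k=1}^{m-1}(-1)^k\sum_{j=1}^{\beta_k}z^{C_{k,j}}\bigr)/\prod_{i=1}^m(1-z^{d_i})$. The alternating power sums are $$\mathbb{C}_n(S_m)=\sum_{k=1}^{m-1}(-1)^{k+1}\sum_{j=1}^{\beta_k}C_{k,j}^n .$$ *)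

(* Defs.v *)
From HB Require Import structures.
From mathcomp Require Export all_boot all_order all_algebra.
From mathcomp Require Export boolp classical_sets cardinality fsbigop.
From mathcomp Require Export mpoly.
Set Implicit Arguments.
Unset Strict Implicit.
Unset Printing Implicit Defensive.
Import Order.TTheory GRing.Theory Num.Theory.
Local Open Scope classical_set_scope.
Local Open Scope ring_scope.

Definition num_semigroup m (d : 'I_m -> nat) : set nat :=
  [set s | exists c : 'I_m -> nat, s = (\sum_(i < m) c i * d i)%N].

Definition minimal_generators m (d : 'I_m -> nat) : Prop :=
  [/\ forall i, (0 < d i)%N,
      \big[gcdn/0%N]_(i < m) d i = 1%N
    & forall i, ~ exists c : 'I_m -> nat,
        d i = (\sum_(j < m | j != i) c j * d j)%N].

(* The sum over the set of gaps is finitely supported, since the gaps of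
   a numerical semigroup are finitely many. *)
Definition genus m (d : 'I_m -> nat) (r : nat) : rat :=
  \sum_(s \in [set s : nat | (0 < s)%N /\ ~ num_semigroup d s])
    (s%:R ^+ r : rat).

Definition gen_prod m (d : 'I_m -> nat) : rat := \prod_(i < m) (d i)%:R.

Definition sigma m (d : 'I_m -> nat) (k : nat) : rat :=
  \sum_(i < m) (d i)%:R ^+ k.

Definition delta m (d : 'I_m -> nat) (k : nat) : rat :=
  (sigma d k - 1) / 2%:R ^+ k.

Definition monomial_deg m (d : 'I_m -> nat) (a : 'X_{1..m}) : nat :=
  (\sum_(i < m) a i * d i)%N.

(* k[S] as the subring of k[t] spanned by the t^s with s in S. *)
Definition semigroup_ring (k : fieldType) m (d : 'I_m -> nat) : set {poly k} :=
  [set q | forall s, q`_s != 0 -> num_semigroup d s].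

(* The graded ring morphism k[x_1, ..., x_m] -> k[t], x_i |-> t^(d_i). *)
Definition augmentation (k : fieldType) m (d : 'I_m -> nat) :
    {mpoly k[m]} -> {poly k} :=
  mmap (@polyC k) (fun i => 'X^(d i)).

(* The degree shifts of the j-th free module F_j, listed with multiplicity:
   F_0 = R(0), and F_j is the sum of the R(-c) for c in C j when j >= 1;
   thus C j lists C_{j,1}, ..., C_{j,beta_j} and its size is beta_j. *)
Definition shifts (C : nat -> seq nat) (j : nat) : seq nat :=
  if j is 0%N then [:: 0%N] else C j.

(* A minimal graded free resolution
     0 -> F_{m-1} -> ... -> F_1 -> F_0 = R -> k[S] -> 0
   of the semigroup ring over R = k[x_1, ..., x_m], deg x_i = d_i.  Elements of
   F_j are row vectors and the differential F_{j+1} -> F_j is the right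
   multiplication by the matrix [diff j]. *)
Record min_graded_resolution (k : fieldType) m (d : 'I_m -> nat) := MinGradedRes {
  syz : nat -> seq nat;
  diff : forall j,
    'M[{mpoly k[m]}]_(size (shifts syz j.+1), size (shifts syz j));
  (* F_j = 0 for j >= m *)
  syz_length : forall j, (m <= j)%N -> syz j = [::];
  (* the differentials are homogeneous of degree 0 *)
  diff_graded : forall j (u : 'I_(size (shifts syz j.+1)))
      (v : 'I_(size (shifts syz j))) (a : 'X_{1..m}),
    a \in msupp (diff j u v) ->
    (monomial_deg d a + nth 0 (shifts syz j) v
     = nth 0 (shifts syz j.+1) u)%N;
  (* minimality: the differentials have entries in the ideal (x_1, ..., x_m) *)
  diff_minimal : forall j (u : 'I_(size (shifts syz j.+1)))
      (v : 'I_(size (shifts syz j))), (diff j u v)@_0%MM = 0;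
  (* exactness at k[S], at F_0 = R, and at F_{j+1} *)
  exact_ring : forall q : {poly k},
    semigroup_ring d q <-> exists p : {mpoly k[m]}, augmentation d p = q;
  exact_base : forall p : {mpoly k[m]},
    augmentation d p = 0 <->
    exists u : 'rV_(size (shifts syz 1)), u *m diff 0 = p%:M;
  exact_syz : forall j (w : 'rV_(size (shifts syz j.+1))),
    w *m diff j = 0 <->
    exists u : 'rV_(size (shifts syz j.+2)), u *m diff j.+1 = w
}.

Definition alt_power_sum (k : fieldType) m (d : 'I_m -> nat)
    (X : min_graded_resolution k d) (n : nat) : rat :=
  \sum_(1 <= j < m) (-1) ^+ j.+1 * \sum_(c <- syz X j) c%:R ^+ n.

(* The linear combination of G_0, ..., G_p, with constant term, whose
   coefficients are the given polynomials evaluated at the power sums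
   sigma_1, ..., sigma_(p+1) of the generators. *)
Definition genera_comb (A : forall p : nat, nat -> {mpoly rat[p.+1]})
    (B : forall p : nat, {mpoly rat[p.+1]})
    m (d : 'I_m -> nat) (p : nat) : rat :=
  \sum_(r < p.+1) (A p r).@[fun i => sigma d i.+1] * genus d r
  + (B p).@[fun i => sigma d i.+1].

(* Main.v *)
From HB Require Import structures.
Require Import Defs.
From mathcomp Require Import ring zify.
Set Implicit Arguments.
Unset Strict Implicit.
Unset Printing Implicit Defensive.
Import Order.TTheory GRing.Theory Num.Theory.
Local Open Scope ring_scope.

(** Counting dimensions in the degree s pieces of the resolution gives
    (1 - z) Q(z) = (1 - (1 - z) Phi(z)) prod_i (1 - z^(d_i)), where Q is the
    alternating sum of the z^(C_(k,j)) and Phi the sum of z^s over the gaps.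
    Substituting z = e^t and writing prod_i (1 - e^(d_i t)) as
    (-t)^m pi_m A(t), the coefficient of t^n gives
    K_p = p! [t^p] A(t) (1 / (e^t - 1) + sum_r G_r t^r / r!).  The logarithmic
    derivative of A is linear in the power sums sigma_k, so the coefficients of
    A are universal polynomials in them, and A(t) t / (e^t - 1) is the same
    series with sigma_k - 1 = 2^k delta_k in place of sigma_k. *)

(** * Formal power series *)

Definition fps (R : Type) := nat -> R.

Section FpsRing.
Context {R : comNzRingType}.
Implicit Types f g h : fps R.

HB.instance Definition _ := gen_eqMixin (fps R).
HB.instance Definition _ := gen_choiceMixin (fps R).

Definition fps_zero : fps R := fun=> 0.
Definition fps_opp f : fps R := fun n => - f n.
Definition fps_add f g : fps R := fun n => f n + g n.
Definition fps_one : fps R := fun n => (n == 0%N)%:R.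
Definition fps_mul f g : fps R := fun n => \sum_(i < n.+1) f i * g (n - i)%N.

Fact fps_addA : associative fps_add.
Proof. by move=> f g h; apply/funext => n; apply: addrA. Qed.
Fact fps_addC : commutative fps_add.
Proof. by move=> f g; apply/funext => n; apply: addrC. Qed.
Fact fps_add0 : left_id fps_zero fps_add.
Proof. by move=> f; apply/funext => n; apply: add0r. Qed.
Fact fps_addN : left_inverse fps_zero fps_opp fps_add.
Proof. by move=> f; apply/funext => n; apply: addNr. Qed.

HB.instance Definition _ :=
  GRing.isZmodule.Build (fps R) fps_addA fps_addC fps_add0 fps_addN.

Definition fps_trunc N f : {poly R} := \poly_(i < N) f i.

Lemma coef_fps_trunc N f i : (i < N)%N -> (fps_trunc N f)`_i = f i.
Proof. by move=> iN; rewrite coef_poly iN. Qed.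

(** A coefficient of a product involves only coefficients of no larger index, so the ring axioms for
    series are inherited from truncations in [{poly R}]. *)
Lemma fps_mul_coef N f g n :
  (n < N)%N -> (fps_trunc N f * fps_trunc N g)`_n = fps_mul f g n.
Proof.
move=> nN; rewrite coefM; apply: eq_bigr => i _.
by rewrite !coef_fps_trunc //; have := ltn_ord i; lia.
Qed.

Fact fps_mulC : commutative fps_mul.
Proof.
by move=> f g; apply/funext => n; rewrite -!(@fps_mul_coef n.+1) // mulrC.
Qed.

Fact fps_mulA : associative fps_mul.
Proof.
move=> f g h; apply/funext => n.
have -> : fps_mul f (fps_mul g h) n
    = (fps_trunc n.+1 f * (fps_trunc n.+1 g * fps_trunc n.+1 h))`_n.
  rewrite coefM; apply: eq_bigr => i _.
  by rewrite fps_mul_coef ?ltnS ?leq_subr // coef_fps_trunc.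
rewrite mulrA coefM; apply: eq_bigr => i _.
by rewrite fps_mul_coef // coef_fps_trunc // ltnS leq_subr.
Qed.

Fact fps_mul1 : left_id fps_one fps_mul.
Proof.
move=> f; apply/funext => n; rewrite /fps_mul big_ord_recl /= mul1r subn0.
by rewrite big1 ?addr0 // => i _; rewrite mul0r.
Qed.

Fact fps_mulDl : left_distributive fps_mul fps_add.
Proof.
move=> f g h; apply/funext => n; rewrite /fps_mul /fps_add -big_split.
by apply: eq_bigr => i _; rewrite mulrDl.
Qed.

Fact fps_oner_neq0 : fps_one != 0.
Proof.
apply/eqP => /(congr1 (fun f : fps R => f 0%N)) /eqP.
by rewrite /fps_one /= oner_eq0.
Qed.

HB.instance Definition _ := GRing.Zmodule_isComNzRing.Build (fps R)
  fps_mulA fps_mulC fps_mul1 fps_mulDl fps_oner_neq0.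

Lemma fpsD f g n : (f + g) n = f n + g n. Proof. by []. Qed.
Lemma fpsB f g n : (f - g) n = f n - g n. Proof. by []. Qed.
Lemma fps1 n : (1 : fps R) n = (n == 0%N)%:R. Proof. by []. Qed.
Lemma fpsM f g n : (f * g) n = \sum_(i < n.+1) f i * g (n - i)%N.
Proof. by []. Qed.

Lemma fps_sum (I : Type) (r : seq I) (P : pred I) (F : I -> fps R) n :
  (\sum_(i <- r | P i) F i) n = \sum_(i <- r | P i) F i n.
Proof. by elim/big_rec2: _ => // i x y _ <-. Qed.

Definition fpsC (c : R) : fps R := fun n => c * (n == 0%N)%:R.

Lemma fpsCM c f n : (fpsC c * f) n = c * f n.
Proof.
rewrite fpsM big_ord_recl /fpsC /= mulr1 subn0 big1 ?addr0 // => i _.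
by rewrite mulr0 mul0r.
Qed.

Fact fpsC_zmod : zmod_morphism fpsC.
Proof. by move=> a b; apply/funext => n; rewrite fpsB /fpsC mulrBl. Qed.

Fact fpsC_monoid : monoid_morphism fpsC.
Proof.
split=> [|a b]; apply/funext => n; first by rewrite /fpsC mul1r.
by rewrite fpsCM /fpsC mulrA.
Qed.

HB.instance Definition _ := GRing.isZmodMorphism.Build R (fps R) fpsC fpsC_zmod.
HB.instance Definition _ :=
  GRing.isMonoidMorphism.Build R (fps R) fpsC fpsC_monoid.

Definition fpsX : fps R := fun n => (n == 1%N)%:R.

Lemma fpsXM f n : (fpsX * f) n = if n is k.+1 then f k else 0.
Proof.
rewrite fpsM; case: n => [|n]; first by rewrite big_ord1 mul0r.
rewrite !big_ord_recl /= mul0r add0r mul1r subSS subn0 big1 ?addr0 // => i _.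
by rewrite /fpsX mul0r.
Qed.

Lemma fpsXnM k f n :
  (fpsX ^+ k * f) n = if (k <= n)%N then f (n - k)%N else 0.
Proof.
elim: k n => [|k IHk] n; first by rewrite mul1r subn0.
by rewrite exprS -mulrA fpsXM; case: n => [|n] //; rewrite IHk ltnS subSS.
Qed.

(** The derivation [t d/dt], preferred to [d/dt] because it shifts no index. *)
Definition fps_euler f : fps R := fun n => n%:R * f n.

Lemma fps_eulerM f g :
  fps_euler (f * g) = fps_euler f * g + f * fps_euler g.
Proof.
apply/funext => n; rewrite fpsD /fps_euler !fpsM mulr_sumr -big_split.
apply: eq_bigr => i _ /=.
have -> : n%:R = i%:R + (n - i)%:R :> R by rewrite -natrD subnKC // -ltnS.
by rewrite mulrDl mulrA mulrCA.
Qed.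

End FpsRing.

(** * Exponential series and the Todd series *)

(** As [g] has no constant term, the equation [t a' = g a] expresses [n a_n] through the [a_i] with
    [i < n], and [n] is invertible for [n > 0]. *)
Lemma eq_fps_euler (g a b : fps rat) :
  g 0%N = 0 -> fps_euler a = g * a -> fps_euler b = g * b ->
  a 0%N = b 0%N -> a = b.
Proof.
move=> g0 Ea Eb ab0; apply/funext => n; elim/ltn_ind: n => -[|n] IHn //.
have /mulfI : n.+1%:R != 0 :> rat by rewrite pnatr_eq0.
apply; have := congr1 (fun f : fps rat => f n.+1) Ea.
have := congr1 (fun f : fps rat => f n.+1) Eb.
rewrite /fps_euler /= !fpsM => -> ->; apply: eq_bigr => -[[|i] ltin] _ /=.
  by rewrite g0 !mul0r.
by rewrite IHn // subSS ltnS leq_subr.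
Qed.

(** Course-of-values recursion: [F] receives the list of all earlier values, whose length is the
    current index. *)
Fixpoint history (T : Type) (F : seq T -> T) n : seq T :=
  if n is n'.+1 then rcons (history F n') (F (history F n')) else [::].

Definition cov_rec (T : Type) (F : seq T -> T) n : T := F (history F n).

Lemma history_mkseq T (F : seq T -> T) n : history F n = mkseq (cov_rec F) n.
Proof. by elim: n => //= n IHn; rewrite mkseqS -IHn. Qed.

Definition exp_fps (x : rat) : fps rat := fun n => x ^+ n / n`!%:R.

(* (e^(xt) - 1) / (xt) *)
Definition expm1_div (x : rat) : fps rat := fun n => x ^+ n / n.+1`!%:R.

Lemma fact_neq0 n : n`!%:R != 0 :> rat.
Proof. by rewrite pnatr_eq0 -lt0n fact_gt0. Qed.

Lemma exp_fpsD x y : exp_fps (x + y) = exp_fps x * exp_fps y.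
Proof.
apply/funext => n; rewrite fpsM /exp_fps addrC exprDn mulr_suml.
apply: eq_bigr => -[i ltin] _ /=; rewrite ltnS in ltin.
rewrite -mulr_natl -(bin_fact ltin) !natrM.
by field; rewrite !fact_neq0 pnatr_eq0 -lt0n bin_gt0.
Qed.

Lemma exp_fps0 : exp_fps 0 = 1.
Proof.
apply/funext => -[|n]; first by rewrite /exp_fps expr0 fact0 divr1.
by rewrite /exp_fps expr0n mul0r.
Qed.

Lemma exp_fpsMn n : exp_fps n%:R = exp_fps 1 ^+ n.
Proof.
by elim: n => [|n IHn]; rewrite ?exp_fps0 // -natr1 exp_fpsD IHn exprSr.
Qed.

Lemma exp_fps_expm1 x : exp_fps x - 1 = fpsC x * (fpsX * expm1_div x).
Proof.
apply/funext => n; rewrite fpsCM fpsXM fpsB fps1.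
case: n => [|n]; first by rewrite /exp_fps expr0 divr1 subrr mulr0.
by rewrite subr0 /exp_fps /expm1_div exprS mulrA.
Qed.

(* The substitution z |-> e^t. *)
Definition exp_subst : {poly rat} -> fps rat :=
  horner_eval (exp_fps 1) \o map_poly fpsC.

HB.instance Definition _ :=
  GRing.RMorphism.copy exp_subst (horner_eval (exp_fps 1) \o map_poly fpsC).

Lemma exp_substXn n : exp_subst 'X^n = exp_fps n%:R.
Proof. by rewrite /exp_subst /= map_polyXn /horner_eval hornerXn exp_fpsMn. Qed.

Lemma exp_substZ a q : exp_subst (a *: q) = fpsC a * exp_subst q.
Proof. by rewrite /exp_subst /= /horner_eval map_polyZ hornerZ. Qed.

(* The coefficients of t u'(t) / u(t) for u = (e^t - 1) / t; up to sign,
   B_n / n!. *)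
Definition todd_coef : nat -> rat := cov_rec (fun l => let n := size l in
  n%:R / n.+1`!%:R - \sum_(k < n) l`_k / (n - k).+1`!%:R).

Lemma todd_coefE n : todd_coef n =
  n%:R / n.+1`!%:R - \sum_(k < n) todd_coef k / (n - k).+1`!%:R.
Proof.
rewrite {1}/todd_coef /cov_rec history_mkseq size_mkseq; congr (_ - _).
by apply: eq_bigr => k _; rewrite nth_mkseq.
Qed.

Lemma todd_coef0 : todd_coef 0 = 0.
Proof. by rewrite todd_coefE big_ord0 mul0r subr0. Qed.

(* The power series exp (sum_(k >= 1) c_k s_k t^k / k), c = todd_coef, so that
   it turns sums of sequences into products and the powers of x into
   (e^(xt) - 1) / (xt). *)
Definition todd (s : nat -> rat) : fps rat := cov_rec (fun l =>
  if size l is n.+1 then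
    (\sum_(k < n.+1) todd_coef k.+1 * s k.+1 * l`_(n - k)) / n.+1%:R
  else 1).

Lemma todd0n s : todd s 0 = 1. Proof. by []. Qed.

Lemma toddS s n : todd s n.+1 =
  (\sum_(k < n.+1) todd_coef k.+1 * s k.+1 * todd s (n - k)%N) / n.+1%:R.
Proof.
rewrite {1}/todd /cov_rec history_mkseq size_mkseq; congr (_ / _).
by apply: eq_bigr => k _; rewrite nth_mkseq // ltnS leq_subr.
Qed.

Lemma todd_euler s :
  fps_euler (todd s) = ((fun n => todd_coef n * s n) : fps rat) * todd s.
Proof.
apply/funext => -[|n]; rewrite /fps_euler fpsM big_ord_recl /= todd_coef0.
  by rewrite big_ord0 !mul0r addr0.
rewrite toddS mulrC divfK ?pnatr_eq0 // !mul0r add0r.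
by apply: eq_bigr => k _; rewrite subSS.
Qed.

Lemma todd_unique s a :
  a 0%N = 1 -> fps_euler a = ((fun n => todd_coef n * s n) : fps rat) * a ->
  a = todd s.
Proof.
move=> a0 Ea; apply: eq_fps_euler Ea (todd_euler s) _ => //.
by rewrite todd_coef0 mul0r.
Qed.

(** Logarithmic derivatives add under multiplication, so the product solves the Euler equation that
    characterises the left side. *)
Lemma toddD s s' : todd (fun k => s k + s' k) = todd s * todd s'.
Proof.
apply/esym/todd_unique; first by rewrite fpsM big_ord1 !todd0n mulr1.
rewrite fps_eulerM !todd_euler mulrCA -mulrA -mulrDl addrC.
by congr (_ * _); apply/funext => n; rewrite fpsD mulrDr addrC.
Qed.

Lemma todd0 : todd (fun=> 0) = 1.
Proof.
apply/esym/todd_unique; rewrite // mulr1; apply/funext => n.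
by rewrite /fps_euler fps1 mulr0; case: n => [|n]; rewrite ?mul0r ?mulr0.
Qed.

Lemma todd_sum (I : Type) (r : seq I) (F : I -> nat -> rat) :
  todd (fun k => \sum_(i <- r) F i k) = \prod_(i <- r) todd (F i).
Proof.
elim: r => [|i r IHr].
  by rewrite big_nil -todd0; congr todd; apply/funext => k; rewrite big_nil.
rewrite big_cons -IHr -toddD; congr todd.
by apply/funext => k; rewrite big_cons.
Qed.

Lemma expm1_div0 x : expm1_div x 0 = 1.
Proof. by rewrite /expm1_div expr0 divr1. Qed.

(** The recursion [todd_coefE] is the Euler equation of [(e^t - 1) / t] solved for its top term;
    replacing [t] by [xt] scales the [k]-th coefficient by [x^k]. *)
Lemma todd_expr x : todd (fun k => x ^+ k) = expm1_div x.
Proof.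
apply/esym/todd_unique; first exact: expm1_div0.
apply/funext => n; rewrite fpsM big_ord_recr /= subnn expm1_div0 mulr1.
rewrite todd_coefE mulrBl mulr_suml addrC -addrA.
rewrite -[LHS]addr0 /fps_euler /expm1_div mulrAC -mulrA; congr (_ + _).
apply/esym/eqP; rewrite addrC subr_eq0; apply/eqP; apply: eq_bigr => i _.
rewrite mulrA -(mulrA (todd_coef i)) -exprD subnKC ?(ltnW (ltn_ord i)) //.
by rewrite mulrAC.
Qed.

(** * Explicit Todd coefficients and polynomials up to order seven *)

Lemma todd_coef1 : todd_coef 1 = 1 / 2%:R.
Proof.
rewrite todd_coefE !big_ord_recr big_ord0 /= todd_coef0 /subn /=.
by rewrite !factS fact0 !natrM; field.
Qed.

Lemma todd_coef2 : todd_coef 2 = 1 / 12%:R.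
Proof.
rewrite todd_coefE !big_ord_recr big_ord0 /= todd_coef0 todd_coef1 /subn /=.
by rewrite !factS fact0 !natrM; field.
Qed.

Lemma todd_coef3 : todd_coef 3 = 0.
Proof.
rewrite todd_coefE !big_ord_recr big_ord0 /= todd_coef0 todd_coef1 todd_coef2 /subn /=.
by rewrite !factS fact0 !natrM; field.
Qed.

Lemma todd_coef4 : todd_coef 4 = - (1 / 720%:R).
Proof.
rewrite todd_coefE !big_ord_recr big_ord0 /= todd_coef0 todd_coef1 todd_coef2.
rewrite todd_coef3 /subn /=.
by rewrite !factS fact0 !natrM; field.
Qed.

Lemma todd_coef5 : todd_coef 5 = 0.
Proof.
rewrite todd_coefE !big_ord_recr big_ord0 /= todd_coef0 todd_coef1 todd_coef2.
rewrite todd_coef3 todd_coef4 /subn /=.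
by rewrite !factS fact0 !natrM; field.
Qed.

Lemma todd_coef6 : todd_coef 6 = 1 / (720%:R * 42%:R).
Proof.
rewrite todd_coefE !big_ord_recr big_ord0 /= todd_coef0 todd_coef1 todd_coef2.
rewrite todd_coef3 todd_coef4 todd_coef5 /subn /=.
by rewrite !factS fact0 !natrM; field.
Qed.

Lemma todd_coef7 : todd_coef 7 = 0.
Proof.
rewrite todd_coefE !big_ord_recr big_ord0 /= todd_coef0 todd_coef1 todd_coef2.
rewrite todd_coef3 todd_coef4 todd_coef5 todd_coef6 /subn /=.
by rewrite !factS fact0 !natrM; field.
Qed.

Lemma todd1 s : todd s 1 = s 1%N / 2%:R.
Proof.
rewrite toddS !big_ord_recr big_ord0 /= /subn /= todd0n todd_coef1.
by field.
Qed.

Lemma todd2 s : todd s 2 = (3%:R * s 1%N ^+ 2 + s 2%N) / 24%:R.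
Proof.
rewrite toddS !big_ord_recr big_ord0 /= /subn /= todd0n todd1.
by rewrite todd_coef1 todd_coef2; field.
Qed.

Lemma todd3 s : todd s 3 = s 1%N * (s 1%N ^+ 2 + s 2%N) / 48%:R.
Proof.
rewrite toddS !big_ord_recr big_ord0 /= /subn /= todd0n todd1 todd2.
by rewrite todd_coef1 todd_coef2 todd_coef3; field.
Qed.

(** The denominator keeps the factor [4!] apart: [4!] times this value is the coefficient of [G_0]
    in [K_4]. Orders 5 and 6 follow the same pattern. *)
Lemma todd4 s : todd s 4 =
  (15%:R * s 1%N ^+ 4 + 30%:R * s 1%N ^+ 2 * s 2%N
   + 5%:R * s 2%N ^+ 2 - 2%:R * s 4%N) / (24%:R * 240%:R).
Proof.
rewrite toddS !big_ord_recr big_ord0 /= /subn /= todd0n todd1 todd2 todd3.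
by rewrite todd_coef1 todd_coef2 todd_coef3 todd_coef4; field.
Qed.

Lemma todd5 s : todd s 5 =
  s 1%N * (3%:R * s 1%N ^+ 4 + 10%:R * s 1%N ^+ 2 * s 2%N
   + 5%:R * s 2%N ^+ 2 - 2%:R * s 4%N) / (120%:R * 96%:R).
Proof.
rewrite toddS !big_ord_recr big_ord0 /= /subn /= todd0n todd1 todd2 todd3 todd4.
by rewrite todd_coef1 todd_coef2 todd_coef3 todd_coef4 todd_coef5; field.
Qed.

Lemma todd6 s : todd s 6 =
  (63%:R * s 1%N ^+ 6 + 315%:R * s 1%N ^+ 4 * s 2%N
   + 315%:R * s 1%N ^+ 2 * s 2%N ^+ 2 - 126%:R * s 1%N ^+ 2 * s 4%N
   + 35%:R * s 2%N ^+ 3 - 42%:R * s 2%N * s 4%N + 16%:R * s 6%N)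
  / (720%:R * 4032%:R).
Proof.
rewrite toddS !big_ord_recr big_ord0 /= /subn /= todd0n todd1 todd2 todd3 todd4.
rewrite todd5 todd_coef1 todd_coef2 todd_coef3 todd_coef4 todd_coef5 todd_coef6.
by field.
Qed.

(** Order 7 serves only the constant term of [K_6]: there [720 = 6!] cancels, and so does
    [128 = 2^7] once [s_k] is replaced by [2^k delta_k]. *)
Lemma todd7 s : todd s 7 =
  s 1%N * (9%:R * s 1%N ^+ 6 + 63%:R * s 1%N ^+ 4 * s 2%N
   + 105%:R * s 1%N ^+ 2 * s 2%N ^+ 2 - 42%:R * s 1%N ^+ 2 * s 4%N
   + 35%:R * s 2%N ^+ 3 - 42%:R * s 2%N * s 4%N + 16%:R * s 6%N)
  / (720%:R * 63%:R * 128%:R).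
Proof.
rewrite toddS !big_ord_recr big_ord0 /= /subn /= todd0n todd1 todd2 todd3 todd4.
rewrite todd5 todd6 todd_coef1 todd_coef2 todd_coef3 todd_coef4 todd_coef5.
by rewrite todd_coef6 todd_coef7; field.
Qed.

(** * Graded pieces of a resolution *)

(** Exactness identifies the row space of [B] with the left kernel of [A]; the rest is
    rank-nullity. *)
Lemma exact_mxrank (k : fieldType) a b c (A : 'M[k]_(a, b)) (B : 'M[k]_(c, a)) :
  (forall w : 'rV_a, w *m A = 0 <-> exists u : 'rV_c, u *m B = w) ->
  a = (\rank A + \rank B)%N.
Proof.
move=> exAB; have -> : \rank B = \rank (kermx A).
  apply/eqP; rewrite eqn_leq !mxrankS //; apply/rV_subP => w.
    by move=> /sub_kermxP /exAB [u <-]; apply: submxMl.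
  by move=> /submxP [u ->]; apply/sub_kermxP/exAB; exists u.
by rewrite mxrank_ker subnKC // rank_leq_row.
Qed.

Section GradedPieces.
Context (k : fieldType) (m : nat) (d : 'I_m -> nat).
Hypothesis d_gt0 : forall i, (0 < d i)%N.
Context (M s : nat).
Hypothesis sM : (s < M)%N.

(* Exponents < M suffice to write all monomials of degree s < M. *)
Definition box_mnm (a : {ffun 'I_m -> 'I_M}) : 'X_{1..m} :=
  [multinom (a i : nat) | i < m].

Lemma box_mnm_inj : injective box_mnm.
Proof.
move=> a b /mnmP ab; apply/ffunP => i; apply: val_inj.
by have := ab i; rewrite !mnmE.
Qed.

Lemma leq_monomial_deg (b : 'X_{1..m}) i : (b i <= monomial_deg d b)%N.
Proof.
rewrite /monomial_deg (bigD1 i) //= (leq_trans (leq_pmulr _ (d_gt0 i))) //.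
exact: leq_addr.
Qed.

Lemma box_mnmP (b : 'X_{1..m}) :
  (monomial_deg d b <= s)%N -> exists a, box_mnm a = b.
Proof.
move=> bs; have bM i : (b i < M)%N.
  exact: leq_ltn_trans (leq_trans (leq_monomial_deg b i) bs) sM.
by exists [ffun i => Ordinal (bM i)]; apply/mnmP => i; rewrite mnmE ffunE.
Qed.

Lemma monomial_degD (a b : 'X_{1..m}) :
  monomial_deg d (a + b) = (monomial_deg d a + monomial_deg d b)%N.
Proof.
by rewrite /monomial_deg -big_split; apply: eq_bigr => i _; rewrite mnmDE mulnDl.
Qed.

(** Pairs of a free generator and a monomial, forming a [k]-basis of the degree [s] piece of the
    free module with shifts [sh]. Through it, exactness over the polynomial ring becomes a statement
    on matrices over [k]. *)
Definition graded_basis (sh : seq nat) :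
    {set 'I_(size sh) * {ffun 'I_m -> 'I_M}} :=
  [set va : 'I_(size sh) * {ffun 'I_m -> 'I_M} |
    (monomial_deg d (box_mnm va.2) + nth 0 sh va.1 == s)%N].

Definition graded_coords sh (w : 'rV[{mpoly k[m]}]_(size sh)) :
    'rV[k]_#|graded_basis sh| :=
  \row_i (w 0 (enum_val i).1)@_(box_mnm (enum_val i).2).

Definition graded_vec sh (x : 'rV[k]_#|graded_basis sh|) :
    'rV[{mpoly k[m]}]_(size sh) :=
  \row_v \sum_i
    (x 0 i * ((enum_val i).1 == v)%:R) *: 'X_[box_mnm (enum_val i).2].

Lemma mcoeff_graded_vec sh (x : 'rV[k]_#|graded_basis sh|) v b :
  (graded_vec x 0 v)@_b =
  \sum_i x 0 i * ((enum_val i).1 == v)%:R * (box_mnm (enum_val i).2 == b)%:R.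
Proof.
rewrite mxE raddf_sum; apply: eq_bigr => i _ /=.
by rewrite mcoeffZ mcoeffX.
Qed.

Lemma graded_vecK sh : cancel (@graded_vec sh) (@graded_coords sh).
Proof.
move=> x; apply/rowP => i; rewrite mxE mcoeff_graded_vec (bigD1 i) //= !eqxx.
rewrite !mulr1 big1 ?addr0 // => j ij.
rewrite -mulrA -natrM mulnb (inj_eq box_mnm_inj) -xpair_eqE -!surjective_pairing.
by rewrite (inj_eq enum_val_inj) (negPf ij) mulr0.
Qed.

(** This composite is not the identity but the projection onto the homogeneous component of degree
    [s]. *)
Lemma graded_coordsK sh (w : 'rV_(size sh)) v b :
  (graded_vec (graded_coords w) 0 v)@_b =
  if (monomial_deg d b + nth 0 sh v == s)%N then (w 0 v)@_b else 0.
Proof.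
rewrite mcoeff_graded_vec; case: ifP => [degb | /negP degb].
  have [a ab] : exists a, box_mnm a = b.
    by apply: box_mnmP; rewrite -(eqP degb) leq_addr.
  have va_in : (v, a) \in graded_basis sh by rewrite inE /= ab.
  rewrite (bigD1 (enum_rank_in va_in (v, a))) //= mxE !enum_rankK_in //= ab.
  rewrite !eqxx !mulr1 big1 ?addr0 // => i /eqP ne_i.
  rewrite -mulrA -natrM mulnb; case: andP => [[/eqP vi /eqP ai]|]; last first.
    by rewrite mulr0.
  case: ne_i; apply: enum_val_inj; rewrite enum_rankK_in //.
  rewrite [LHS]surjective_pairing vi; congr pair.
  by apply: box_mnm_inj; rewrite ai ab.
rewrite big1 // => i _; rewrite -mulrA -natrM mulnb.
case: andP => [[/eqP vi /eqP ai]|]; last by rewrite mulr0.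
by have := enum_valP i; rewrite inE vi ai => /degb.
Qed.

Lemma graded_vec_linear sh c (x y : 'rV_#|graded_basis sh|) :
  graded_vec (c *: x + y) = c%:MP *: graded_vec x + graded_vec y.
Proof.
apply/rowP => v; rewrite !mxE mulr_sumr -big_split; apply: eq_bigr => i _ /=.
by rewrite !mxE mul_mpolyC scalerA mulrA -scalerDl -mulrDl.
Qed.

Lemma graded_coords_linear sh c (w w' : 'rV_(size sh)) :
  graded_coords (c%:MP *: w + w') = c *: graded_coords w + graded_coords w'.
Proof. by apply/rowP => i; rewrite !mxE mcoeffD mcoeffCM. Qed.

Section Differential.
Context (sh sh' : seq nat) (T : 'M[{mpoly k[m]}]_(size sh', size sh)).
Hypothesis T_graded : forall u v a, a \in msupp (T u v) ->
  (monomial_deg d a + nth 0 sh v = nth 0 sh' u)%N.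

Definition graded_map (x : 'rV[k]_#|graded_basis sh'|) :=
  graded_coords (graded_vec x *m T).

Fact graded_map_linear : linear graded_map.
Proof.
move=> c x y.
by rewrite /graded_map graded_vec_linear mulmxDl -scalemxAl graded_coords_linear.
Qed.

HB.instance Definition _ :=
  GRing.isLinear.Build k _ _ _ graded_map graded_map_linear.

(** A homogeneous map commutes with the projection onto degree [s]: wherever an entry of [T] has a
    nonzero coefficient, the degree conditions at source and target coincide. *)
Lemma graded_vec_mulmx (w : 'rV_(size sh')) :
  graded_vec (graded_coords (w *m T)) = graded_vec (graded_coords w) *m T.
Proof.
apply/rowP => v; apply/mpolyP => b; rewrite graded_coordsK !mxE !raddf_sum /=.
have -> : forall (P : bool) (F : 'I_(size sh') -> k),
    (if P then \sum_u F u else 0) = \sum_u (if P then F u else 0).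
  by move=> [] F //; rewrite big1.
apply: eq_bigr => u _; rewrite !mcoeffM.
transitivity (
  \sum_(c : 'X_{1..m < (mdeg b).+1, (mdeg b).+1} | b == (c.1 + c.2)%MM)
    if (monomial_deg d b + nth 0 sh v == s)%N
    then (w 0 u)@_c.1 * (T u v)@_c.2 else 0).
  by case: ifP => // _; rewrite big1.
apply: eq_bigr => c /eqP bc; rewrite graded_coordsK.
have [c2T|/memN_msupp_eq0 ->] := boolP (val c.2 \in msupp (T u v)); last first.
  by rewrite !mulr0 if_same.
rewrite -(T_graded c2T) addnA -monomial_degD -bc.
by case: ifP => // _; rewrite mul0r.
Qed.

Lemma graded_mapE w : graded_map (graded_coords w) = graded_coords (w *m T).
Proof. by rewrite /graded_map -graded_vec_mulmx graded_vecK. Qed.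

Lemma graded_map_eq0 x : graded_map x = 0 <-> graded_vec x *m T = 0.
Proof.
split=> [x0|xT]; last first.
  by rewrite /graded_map xT; apply/rowP => i; rewrite !mxE mcoeff0.
rewrite -{1}(graded_vecK x) -graded_vec_mulmx -/(graded_map x) x0.
by apply/rowP => v; rewrite !mxE big1 // => i _; rewrite mxE mul0r scale0r.
Qed.

End Differential.


Lemma augmentation_graded_vec (x : 'rV[k]_#|graded_basis [:: 0%N]|) :
  augmentation d (graded_vec x 0 0) = (\sum_i x 0 i) *: 'X^s.
Proof.
rewrite /augmentation mxE raddf_sum scaler_suml; apply: eq_bigr => i _ /=.
rewrite (ord1 (enum_val i).1) eqxx mulr1 mmapZ mmapX mul_polyC; congr (_ *: _).
rewrite /mmap1 -(eqP (_ : monomial_deg d (box_mnm (enum_val i).2) == s)).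
  by rewrite /monomial_deg -prodrXr; apply: eq_bigr => j _; rewrite -exprM mulnC.
by have := enum_valP i; rewrite inE (ord1 (enum_val i).1) addn0.
Qed.

(** In degree [s] every monomial maps to [X^s], so the augmentation is a column of ones. Its rank is
    1 exactly when some monomial has degree [s]. *)
Lemma mxrank_graded_augmentation :
  \rank (const_mx 1 : 'M[k]_(#|graded_basis [:: 0%N]|, 1))
  = `[< num_semigroup d s >] :> nat.
Proof.
case: asboolP => [[c sE]|notS].
  apply/eqP; rewrite eqn_leq rank_leq_col lt0n mxrank_eq0.
  have degc : monomial_deg d [multinom c i | i < m] = s.
    by rewrite sE; apply: eq_bigr => i _; rewrite mnmE.
  have [|a ac] := @box_mnmP [multinom c i | i < m]; first by rewrite degc.
  have a_in : (0, a) \in graded_basis [:: 0%N] by rewrite inE /= ac degc addn0.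
  apply/eqP => /matrixP /(_ (enum_rank_in a_in (0, a)) 0) /eqP.
  by rewrite !mxE oner_eq0.
suff -> : #|graded_basis [:: 0%N]| = 0%N by rewrite mxrank.unlock.
apply/eqP; rewrite cards_eq0; apply/eqP/setP => va; rewrite !inE.
apply/negP => /eqP vas; apply: notS; exists (fun i => va.2 i : nat).
rewrite -vas (ord1 va.1) addn0; apply: eq_bigr => i _; by rewrite mnmE.
Qed.

End GradedPieces.

(** * The Hilbert series computed from a resolution *)

Section HilbertSeries.
Context (k : fieldType) (m : nat) (d : 'I_m -> nat).
Hypothesis d_gt0 : forall i, (0 < d i)%N.
Context (X : min_graded_resolution k d).
Implicit Types M s j : nat.

Definition graded_diff M s j :=
  lin1_mx (@graded_map k m d M s _ _ (diff X j)).

Lemma mul_graded_diff M s j x :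
  x *m graded_diff M s j = graded_map (diff X j) x.
Proof. exact: mul_rV_lin1. Qed.

Lemma graded_exact_base M s : (s < M)%N ->
  #|graded_basis d M s [:: 0%N]|
  = (`[< num_semigroup d s >] + \rank (graded_diff M s 0))%N.
Proof.
move=> sM; rewrite -(mxrank_graded_augmentation k d_gt0 sM).
apply: exact_mxrank => w.
have sumE : w *m (const_mx 1 : 'cV_ _) = (\sum_i w 0 i)%:M.
  apply/matrixP => i j; rewrite (ord1 i) (ord1 j) !mxE eqxx mulr1n.
  by apply: eq_bigr => l _; rewrite mxE mulr1.
have -> : w *m (const_mx 1 : 'cV_ _) = 0
    <-> augmentation d (graded_vec w 0 0) = 0.
  rewrite augmentation_graded_vec sumE; split=> [/(congr1 (fun A : 'M_1 => A 0 0))|].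
    by rewrite !mxE eqxx mulr1n => ->; rewrite scale0r.
  move/eqP; rewrite scaler_eq0 (negPf (monic_neq0 (monicXn k s))) orbF => /eqP ->.
  by rewrite raddf0.
rewrite (exact_base X); split=> [[u uE]|[u <-]].
  (* The preimage [u] need not be homogeneous, but its component of degree [s] still maps to the
     homogeneous [w]. *)
  exists (graded_coords d M s u); rewrite mul_graded_diff graded_mapE //;
    last exact: diff_graded.
  rewrite uE -[RHS](graded_vecK w); congr graded_coords.
  by apply/rowP => v; rewrite (ord1 v) mxE eqxx mulr1n.
rewrite mul_graded_diff /graded_map.
rewrite graded_vec_mulmx //; last exact: diff_graded.
rewrite graded_vecK //.
exists (graded_vec u); apply/matrixP => i j.
by rewrite (ord1 i) (ord1 j) [RHS]mxE eqxx mulr1n.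
Qed.

Lemma graded_exact_syz M s j : (s < M)%N ->
  #|graded_basis d M s (syz X j.+1)|
  = (\rank (graded_diff M s j) + \rank (graded_diff M s j.+1))%N.
Proof.
move=> sM; apply: exact_mxrank => w.
rewrite mul_graded_diff graded_map_eq0 //; last exact: diff_graded.
rewrite exact_syz; split=> [[u uE]|[u <-]].
  exists (graded_coords d M s u); rewrite mul_graded_diff graded_mapE //;
    last exact: diff_graded.
  by rewrite uE graded_vecK.
exists (graded_vec u).
rewrite mul_graded_diff /graded_map graded_vec_mulmx //; last exact: diff_graded.
by rewrite graded_vecK.
Qed.

Lemma graded_euler_char M s : (s < M)%N -> (0 < m)%N ->
  \sum_(0 <= j < m) (-1) ^+ j * #|graded_basis d M s (shifts (syz X) j)|%:R
  = `[< num_semigroup d s >]%:R :> rat.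
Proof.
move=> sM m_gt0; pose r j := \rank (graded_diff M s j).
(* Each dimension is a sum of two neighbouring ranks, so the alternating sum telescopes, leaving the
   semigroup indicator and one last rank. *)
have partial n : (0 < n)%N ->
    \sum_(0 <= j < n) (-1) ^+ j * #|graded_basis d M s (shifts (syz X) j)|%:R
    = `[< num_semigroup d s >]%:R + (-1) ^+ n.-1 * (r n.-1)%:R :> rat.
  case: n => // n _; elim: n => [|n IHn].
    by rewrite big_nat1 !mul1r [shifts _ _]/= (graded_exact_base sM) natrD.
  rewrite big_nat_recr // IHn [shifts _ _]/= (graded_exact_syz n sM) natrD.
  by rewrite exprS /= -/(r n) -/(r n.+1); ring.
rewrite partial //.
(* The differential of index [m - 1] starts from [F_m = 0]. *)
suff -> : r m.-1 = 0%N by rewrite mulr0 addr0.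
apply/eqP; rewrite -leqn0 (leq_trans (rank_leq_row _)) //.
rewrite leqn0 cards_eq0; apply/eqP/setP => -[v a]; exfalso.
by move: v; rewrite /= (prednK m_gt0) syz_length // => -[].
Qed.

Definition hilbert_num : {poly rat} :=
  \sum_(0 <= j < m) (-1) ^+ j *: \sum_(c <- shifts (syz X) j) 'X^c.

(** Expanding the product of truncated geometric sums gives one term for each exponent vector of the
    box, with the degree of its monomial as exponent. *)
Lemma card_graded_basis M s sh :
  #|graded_basis d M s sh|%:R
  = ((\sum_(c <- sh) 'X^c) *
     \prod_(i < m) \sum_(j < M) ('X^(d i)) ^+ j : {poly rat})`_s.
Proof.
rewrite bigA_distr_bigA /= (big_nth 0%N) big_mkord mulr_suml coef_sum.
rewrite -sum1_card natr_sum [LHS]big_mkcond /=.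
transitivity (
  \sum_v \sum_a (if (v, a) \in graded_basis d M s sh then 1 else 0) : rat).
  by rewrite pair_big; apply: eq_bigr => -[v a].
apply: eq_bigr => v _; rewrite mulr_sumr coef_sum; apply: eq_bigr => a _.
rewrite inE -(_ : 'X^(monomial_deg d (box_mnm a)) = \prod_i ('X^(d i)) ^+ a i).
  by rewrite -exprD coefXn addnC eq_sym; case: eqP.
rewrite /monomial_deg -prodrXr; apply: eq_bigr => i _.
by rewrite mnmE -exprM mulnC.
Qed.

Lemma coef_hilbert_num M s : (s < M)%N -> (0 < m)%N ->
  (hilbert_num * \prod_(i < m) \sum_(j < M) ('X^(d i)) ^+ j)`_s
  = `[< num_semigroup d s >]%:R.
Proof.
move=> sM m_gt0; rewrite -(graded_euler_char sM m_gt0) mulr_suml coef_sum.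
by apply: eq_bigr => j _; rewrite card_graded_basis -scalerAl coefZ.
Qed.

End HilbertSeries.

(** * Gaps and the numerator of the Hilbert series *)

Section Gaps.
Context (m : nat) (d : 'I_m -> nat).

Lemma num_semigroup0 : num_semigroup d 0.
Proof. by exists (fun=> 0%N); rewrite big1 // => i _; rewrite mul0n. Qed.

Lemma num_semigroup_gen i : num_semigroup d (d i).
Proof.
exists (fun j => (j == i)%N : nat); rewrite (bigD1 i) //= eqxx mul1n big1 ?addn0 //.
by move=> j /negPf ->; rewrite mul0n.
Qed.

Lemma num_semigroupD a b :
  num_semigroup d a -> num_semigroup d b -> num_semigroup d (a + b)%N.
Proof.
move=> [u ->] [v ->]; exists (fun i => u i + v i)%N.
by rewrite -big_split; apply: eq_bigr => i _; rewrite mulnDl.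
Qed.

Lemma num_semigroupM n a : num_semigroup d a -> num_semigroup d (n * a)%N.
Proof.
move=> [u ->]; exists (fun i => n * u i)%N; rewrite big_distrr /=.
by apply: eq_bigr => i _; rewrite mulnA.
Qed.

(** Bezout without subtraction: being a difference of two semigroup elements passes from [a] and [b]
    to their gcd. *)
Lemma num_semigroup_gcd_diff : exists v,
  num_semigroup d v /\ num_semigroup d (v + \big[gcdn/0%N]_(i < m) d i)%N.
Proof.
apply: (big_ind (fun g => exists v,
  num_semigroup d v /\ num_semigroup d (v + g)%N)) =>
  [|a b [v [Sv Sva]] [w [Sw Swb]]|i _].
- by exists 0%N; split; apply: num_semigroup0.
- have [->|a_gt0] := posnP a; first by exists w; rewrite gcd0n.
  have [x _ /dvdnP [y yE]] := Bezoutl b a_gt0.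
  (* Since [gcd + x b = y a], adding the gcd to this element gives [y (v + a) + x w]. *)
  exists (y * v + x * (w + b))%N; split.
    by apply: num_semigroupD; apply: num_semigroupM.
  rewrite (_ : (_ + _)%N = (y * (v + a) + x * w)%N); last by nia.
  by apply: num_semigroupD; apply: num_semigroupM.
- exists 0%N; split; [exact: num_semigroup0 | exact: num_semigroup_gen].
Qed.

Lemma num_semigroup_cofinite : \big[gcdn/0%N]_(i < m) d i = 1%N ->
  exists N, forall n, (N <= n)%N -> num_semigroup d n.
Proof.
move=> gcd1; have [v] := num_semigroup_gcd_diff; rewrite gcd1 => -[Sv Sv1].
(* If [v = 0], then 1 lies in the semigroup. Otherwise [n = q v + r = (q - r) v + r (v + 1)], where
   [r < v <= q] because [n >= v^2]. *)
exists (v * v)%N => n vn; have [v0|v_gt0] := posnP v.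
  by rewrite -[n]muln1; apply: num_semigroupM; move: Sv1; rewrite v0.
have rv := ltn_pmod n v_gt0; have vq : (v <= n %/ v)%N by rewrite leq_divRL.
rewrite (_ : n = (n %/ v - n %% v) * v + n %% v * (v + 1))%N.
  by apply: num_semigroupD; apply: num_semigroupM.
have := divn_eq n v; move: (n %/ v)%N (n %% v)%N rv vq => q r rv vq ->.
by rewrite mulnBl mulnDr muln1 addnA subnK // leq_mul2r ltnW ?orbT // (leq_trans rv).
Qed.

Context (N : nat).
Hypothesis SN : forall n, (N <= n)%N -> num_semigroup d n.

Lemma genusE r : genus d r =
  \sum_(0 <= s < N | ~~ `[< num_semigroup d s >]) s%:R ^+ r.
Proof.
rewrite /genus (fsbigE [seq s <- iota 0 N | ~~ `[< num_semigroup d s >]]).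
- rewrite big_filter_cond /index_iota subn0; apply: eq_bigl => s.
  apply: andb_idr => /asboolPn notS; rewrite inE; split=> //.
  by case: s notS => // /(_ num_semigroup0).
- by rewrite filter_uniq ?iota_uniq.
- move=> s /=; rewrite mem_filter => /andP [/asboolPn notS _]; split=> //.
  by case: s notS => // /(_ num_semigroup0).
- move=> s [_ notS]; rewrite mem_filter mem_iota add0n => /negP; case.
  apply/andP; split; first exact/asboolPn.
  by rewrite /= ltnNge; apply/negP => /SN.
Qed.

Definition gap_poly : {poly rat} :=
  \sum_(0 <= s < N | ~~ `[< num_semigroup d s >]) 'X^s.

(** Semigroup elements and gaps below [M] together make up a full geometric sum, and all gaps
    already lie below [N]. *)
Lemma mul_subX_gap_poly M : (N <= M)%N ->
  (1 - 'X) * \sum_(0 <= s < M | `[< num_semigroup d s >]) 'X^s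
  = 1 - 'X^M - (1 - 'X) * gap_poly.
Proof.
move=> NM.
have -> : gap_poly = \sum_(0 <= s < M | ~~ `[< num_semigroup d s >]) 'X^s.
  rewrite (big_cat_nat (leq0n N) NM) /= [X in _ + X]big_nat_cond.
  rewrite [X in _ + X]big_pred0 ?addr0 //.
  move=> s; apply/negP => /andP [/andP [Ns _]].
  by move=> /asboolPn; apply; apply: SN.
rewrite -[1 - 'X^M]opprB subrX1 -mulNr opprB -(big_mkord predT (fun s => 'X^s)).
rewrite (bigID (fun s => `[< num_semigroup d s >]) predT) /=.
by rewrite mulrDr addrK.
Qed.

End Gaps.

Lemma coef_eq0_divXn (R : nzRingType) M (p : {poly R}) :
  (forall i, (i < M)%N -> p`_i = 0) -> exists q, p = q * 'X^M.
Proof.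
move=> p0; exists (drop_poly M p); rewrite -{1}(poly_take_drop M p).
rewrite (_ : take_poly M p = 0) ?add0r //; apply/polyP => i.
by rewrite coef_take_poly coef0; case: ifP => // /p0.
Qed.

(** Division by [p] modulo [x]: [b] is an inverse of [p] up to a multiple of [x], and the error
    terms are kept explicit. *)
Lemma clear_denominator (R : comNzRingType) (y q b p h f x r1 r2 : R) :
  b * p = 1 + r2 * x -> q * b = h + r1 * x -> y * h = 1 - x - y * f ->
  y * q = (1 - y * f) * p + (y * r1 * p - p - y * q * r2) * x.
Proof.
move=> bp qb yh.
transitivity (y * (q * b) * p - y * q * (b * p - 1)); first by ring.
by rewrite {}bp {}qb mulrDr {}yh; ring.
Qed.

(* The identity is tested modulo X^M for all large M, where the geometric sums
   stand for the factors 1 / (1 - X^(d i)). *)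
Lemma poly_hilbert_num m (d : 'I_m -> nat) N (Q : {poly rat}) :
  (forall i, (0 < d i)%N) -> (forall n, (N <= n)%N -> num_semigroup d n) ->
  (forall M s, (s < M)%N ->
    (Q * \prod_(i < m) \sum_(j < M) 'X^(d i) ^+ j)`_s
    = `[< num_semigroup d s >]%:R) ->
  (1 - 'X) * Q = (1 - (1 - 'X) * gap_poly d N) * \prod_(i < m) (1 - 'X^(d i)).
Proof.
move=> d_gt0 SN coef_Q_box; apply/polyP => n.
(* [M] must exceed every gap and also the index [n] of the compared coefficient, so that the error
   multiple of [X^M] does not reach it. *)
pose M := maxn N n.+1.
have NM : (N <= M)%N by apply: leq_maxl.
have nM : (n < M)%N by apply: leq_maxr.
set P := \prod_(i < m) (1 - _); set Phi := gap_poly d N.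
pose B M : {poly rat} := \prod_(i < m) \sum_(j < M) 'X^(d i) ^+ j.
pose H : {poly rat} := \sum_(0 <= s < M | `[< num_semigroup d s >]) 'X^s.
have [R1 QB] : exists R, Q * B M - H = R * 'X^M.
  apply: coef_eq0_divXn => i iM; rewrite coefB /B coef_Q_box // /H big_mkcond.
  rewrite big_mkord coef_sum.
  rewrite (bigD1 (Ordinal iM)) //= big1 ?addr0 => [|j ji].
    by case: ifP => _; rewrite ?coefXn ?eqxx ?coef0 subrr.
  case: ifP => _; rewrite ?coef0 // coefXn.
  by case: eqP => // ij; case/eqP: ji; apply: val_inj.
have [R2 BP] : exists R, B M * P = 1 + R * 'X^M.
  rewrite -big_split /=; apply: (big_ind (fun p => exists R, p = 1 + R * 'X^M)).
  - by exists 0; rewrite mul0r addr0.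
  - by move=> p q [R ->] [R' ->]; exists (R + R' + R * R' * 'X^M); ring.
  (* The product telescopes to [1 - X^(M d_i)], and [X^M] splits off because [d_i >= 1]. *)
  move=> i _; exists (- 'X^(M * (d i).-1)).
  rewrite mulrC -opprB mulNr -subrX1 opprB mulNr -exprD -exprM.
  by rewrite -mulnSr prednK // mulnC.
have HE := mul_subX_gap_poly SN NM; rewrite -/H -/Phi in HE.
suff [R ->] : exists R, (1 - 'X) * Q = (1 - (1 - 'X) * Phi) * P + R * 'X^M.
  by rewrite coefD coefMXn nM addr0.
exists ((1 - 'X) * R1 * P - P - (1 - 'X) * Q * R2).
by apply: clear_denominator BP _ HE; rewrite -QB addrC subrK.
Qed.

(** * The alternating power sums *)

(** The recursion [toddS] is polynomial in [s_1, ..., s_n], so [q] is chosen before [s] and is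
    independent of the semigroup. The shift [a] is 0 for the genus coefficients and -1 for the
    constant term. *)
Lemma exists_todd_mpoly (a : rat) p n : exists q : {mpoly rat[p.+1]},
  (n <= p.+1)%N ->
  forall s : nat -> rat, q.@[fun i => s i.+1] = todd (fun k => s k + a) n.
Proof.
elim/ltn_ind: n => -[|n] IHn; first by exists 1 => _ s; rewrite meval1.
have /choice [q qE] : forall k : 'I_n.+1, exists q : {mpoly rat[p.+1]},
    (n - k <= p.+1)%N ->
    forall s : nat -> rat,
      q.@[fun i => s i.+1] = todd (fun k => s k + a) (n - k)%N.
  by move=> k; apply: IHn; rewrite ltnS leq_subr.
(* Variable [k] stands for [s_(k+1)]; [inord k] is the true index because [k <= n <= p]. *)
exists (n.+1%:R^-1 *:
  \sum_(k < n.+1) (todd_coef k.+1 *: (('X_(inord k) + a%:MP) * q k))).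
move=> np s; rewrite mevalZ raddf_sum mulrC toddS; congr (_ / _).
apply: eq_bigr => k _ /=; rewrite mevalZ mevalM mevalD mevalXU mevalC qE.
  by rewrite inordK ?mulrA // (leq_trans (ltn_ord k)).
by apply: leq_trans (leq_subr _ _) (ltnW np).
Qed.

Definition todd_mpoly (a : rat) p n : {mpoly rat[p.+1]} :=
  sval (cid (exists_todd_mpoly a p n)).

Lemma meval_todd_mpoly a p n s : (n <= p.+1)%N ->
  (todd_mpoly a p n).@[fun i => s i.+1] = todd (fun k => s k + a) n.
Proof. by move=> np; apply: (svalP (cid (exists_todd_mpoly a p n))). Qed.

(** The numerical factor is [p! / r!], from convolving with the exponential generating series of the
    genera. *)
Definition genus_coef p r : {mpoly rat[p.+1]} :=
  ('C(p, r) * (p - r)`!)%:R *: todd_mpoly 0 p (p - r).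

(** The order is [p + 1] rather than [p] because [1 / (e^t - 1)] has a simple pole at 0. *)
Definition genera_const p : {mpoly rat[p.+1]} :=
  p`!%:R *: todd_mpoly (- 1) p p.+1.

Lemma genera_combE m (d : 'I_m -> nat) p :
  genera_comb genus_coef genera_const d p =
  \sum_(r < p.+1)
    ('C(p, r) * (p - r)`!)%:R * todd (sigma d) (p - r)%N * genus d r
  + p`!%:R * todd (fun k => sigma d k - 1) p.+1.
Proof.
rewrite /genera_comb mevalZ meval_todd_mpoly //; congr (_ + _).
apply: eq_bigr => r _; rewrite mevalZ meval_todd_mpoly; last first.
  exact: leq_trans (leq_subr _ _) (leqnSn _).
by under [X in todd X]eq_fun do rewrite addr0.
Qed.

Lemma exp_subst_1BXn n :
  exp_subst (1 - 'X^n) = - (fpsX * (fpsC n%:R * todd (fun k => n%:R ^+ k))).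
Proof.
by rewrite rmorphB rmorph1 /= exp_substXn -opprB exp_fps_expm1 todd_expr mulrCA.
Qed.

Lemma exp_subst_prod m (d : 'I_m -> nat) :
  exp_subst (\prod_(i < m) (1 - 'X^(d i)))
  = (-1) ^+ m * fpsX ^+ m * (fpsC (gen_prod d) * todd (sigma d)).
Proof.
rewrite rmorph_prod /=; under eq_bigr do rewrite exp_subst_1BXn -mulN1r mulrA.
rewrite !big_split /= !prodr_const card_ord -rmorph_prod -todd_sum.
by rewrite !mulrA.
Qed.

(** Division by the unit [u = (e^t - 1) / t] with inverse [v], where [x] is [t], [f] the gap series
    and [u * w] the Todd series of the power sums. Only the term containing [f] keeps its [u]. *)
Lemma cancel_unit (R : comNzRingType) (x q f u v w c y : R) n :
  u * v = 1 ->
  - (x * u) * q = (1 - - (x * u) * f) * ((-1) ^+ n * y * (c * (u * w))) ->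
  x * q = y * ((-1) ^+ n.+1 * c * (w + x * (f * (u * w)))).
Proof.
move=> uv E; transitivity (- (- (x * u) * q) * v).
  by rewrite -[LHS]mulr1 -uv; ring.
by rewrite E exprS -[RHS]mul1r -[X in _ = X * _]uv; ring.
Qed.

Section GapSeries.
Context (m : nat) (d : 'I_m -> nat).
Context (N : nat).
Hypothesis SN : forall n, (N <= n)%N -> num_semigroup d n.

Lemma exp_subst_gap_poly r : exp_subst (gap_poly d N) r = genus d r / r`!%:R.
Proof.
rewrite (genusE SN) mulr_suml rmorph_sum fps_sum /=; apply: eq_bigr => s _.
by rewrite exp_substXn.
Qed.

Lemma exp_subst_hilbert_num (Q : {poly rat}) n :
  (1 - 'X) * Q = (1 - (1 - 'X) * gap_poly d N) * \prod_(i < m) (1 - 'X^(d i)) ->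
  (m <= n)%N ->
  exp_subst Q n = (-1) ^+ m.+1 * (gen_prod d / (n - m)`!%:R)
    * genera_comb genus_coef genera_const d (n - m)%N.
Proof.
move=> Qeq mn; pose u := todd (fun k => 1%:R ^+ k).
have E1BX : exp_subst (1 - 'X) = - (fpsX * u).
  by rewrite -['X]expr1 exp_subst_1BXn rmorph1 mul1r.
have := congr1 exp_subst Qeq; rewrite rmorphM [RHS]rmorphM /= exp_subst_prod.
rewrite [exp_subst (1 - _ * _)]rmorphB rmorph1 rmorphM /= E1BX => EQ.
set W := todd (fun k => sigma d k - 1).
(* The sequences 1 and -1 add up to 0, so their Todd series are mutually inverse; likewise
   [sigma_k = 1 + (sigma_k - 1)] yields [AE]. *)
have uV : u * todd (fun=> - 1) = 1.
  by rewrite -toddD -todd0; congr todd; apply/funext => k; rewrite expr1n subrr.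
have AE : todd (sigma d) = u * W.
  by rewrite -toddD; congr todd; apply/funext => k; rewrite expr1n addrC subrK.
have {}EQ : fpsX * exp_subst Q = fpsX ^+ m * (fpsC ((-1) ^+ m.+1 * gen_prod d)
   * (W + fpsX * (exp_subst (gap_poly d N) * todd (sigma d)))).
  rewrite rmorphM rmorphXn rmorphN1 AE; apply: cancel_unit uV _.
  by rewrite EQ AE.
(* Index [n + 1] makes up for the factor [t] on the left. On the right, [W] is read at [n - m + 1]
   and the gap product, having its own factor [t], at [n - m]. *)
have := congr1 (fun f : fps rat => f n.+1) EQ.
rewrite fpsXM fpsXnM (leqW mn) fpsCM subSn // fpsD fpsXM => ->.
rewrite -!mulrA; congr (_ * (_ * _)); rewrite genera_combE.
set p := (n - m)%N.
rewrite mulrDr mulKf ?fact_neq0 // addrC; congr (_ + _).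
rewrite fpsM mulr_sumr; apply: eq_bigr => r _; rewrite exp_subst_gap_poly.
have rp : (r <= p)%N by rewrite -ltnS.
rewrite natrM -{1}(bin_fact rp) !natrM.
by field; rewrite !fact_neq0 pnatr_eq0 -lt0n bin_gt0.
Qed.

End GapSeries.

Lemma alt_power_sumE (k : fieldType) m (d : 'I_m -> nat)
    (X : min_graded_resolution k d) n : (0 < m)%N -> (0 < n)%N ->
  alt_power_sum X n = - n`!%:R * exp_subst (hilbert_num X) n.
Proof.
move=> m_gt0 n_gt0.
(* The summand [j = 0] of the numerator is the constant 1, which contributes nothing to a
   coefficient of positive index. *)
have E0 : exp_fps 0 n = 0 by rewrite /exp_fps expr0n gtn_eqF // mul0r.
rewrite /hilbert_num rmorph_sum fps_sum /= big_ltn // mulrDr.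
rewrite [X in X + _](_ : _ = 0) ?add0r; last first.
  by rewrite expr0 scale1r big_seq1 exp_substXn E0 mulr0.
rewrite mulr_sumr; apply: eq_big_nat => j /andP [j_gt0 _].
rewrite exp_substZ fpsCM rmorph_sum fps_sum /= exprS.
case: j j_gt0 => // j _; rewrite [shifts _ _]/=.
have -> : \sum_(c <- syz X j.+1) exp_subst 'X^c n
    = (\sum_(c <- syz X j.+1) c%:R ^+ n) / n`!%:R.
  by rewrite mulr_suml; apply: eq_bigr => c _; rewrite exp_substXn.
by field; rewrite fact_neq0.
Qed.

Theorem mainTheorem6 :
  exists (A : forall p : nat, nat -> {mpoly rat[p.+1]})
         (B : forall p : nat, {mpoly rat[p.+1]}),
  forall (m : nat) (d : 'I_m -> nat),
  (2 <= m)%N -> minimal_generators d ->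
  let K := genera_comb A B d in
  let G := genus d in
  let s := sigma d in
  let t := delta d in
  (forall (k : fieldType) (X : min_graded_resolution k d) (n : nat),
     (m <= n)%N ->
     alt_power_sum X n
     = (-1) ^+ m * n`!%:R / (n - m)`!%:R * gen_prod d * K (n - m)%N)
  /\ K 0%N = G 0%N + t 1%N
  /\ K 1%N = G 1%N + s 1%N / 2%:R * G 0%N + (3%:R * t 1%N ^+ 2 + t 2%N) / 6%:R
  /\ K 2%N = G 2%N + s 1%N * G 1%N
       + (3%:R * s 1%N ^+ 2 + s 2%N) / 12%:R * G 0%N
       + t 1%N * (t 1%N ^+ 2 + t 2%N) / 3%:R
  /\ K 3%N = G 3%N + 3%:R / 2%:R * s 1%N * G 2%N
       + (3%:R * s 1%N ^+ 2 + s 2%N) / 4%:R * G 1%N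
       + s 1%N * (s 1%N ^+ 2 + s 2%N) / 8%:R * G 0%N
       + (15%:R * t 1%N ^+ 4 + 30%:R * t 1%N ^+ 2 * t 2%N
          + 5%:R * t 2%N ^+ 2 - 2%:R * t 4%N) / 60%:R
  /\ K 4%N = G 4%N + 2%:R * s 1%N * G 3%N
       + (3%:R * s 1%N ^+ 2 + s 2%N) / 2%:R * G 2%N
       + s 1%N * (s 1%N ^+ 2 + s 2%N) / 2%:R * G 1%N
       + (15%:R * s 1%N ^+ 4 + 30%:R * s 1%N ^+ 2 * s 2%N
          + 5%:R * s 2%N ^+ 2 - 2%:R * s 4%N) / 240%:R * G 0%N
       + t 1%N * ((3%:R * t 1%N ^+ 4 + 10%:R * t 1%N ^+ 2 * t 2%N
          + 5%:R * t 2%N ^+ 2 - 2%:R * t 4%N) / 15%:R)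
  /\ K 5%N = G 5%N + 5%:R / 2%:R * s 1%N * G 4%N
       + 5%:R / 6%:R * (3%:R * s 1%N ^+ 2 + s 2%N) * G 3%N
       + 5%:R / 4%:R * s 1%N * (s 1%N ^+ 2 + s 2%N) * G 2%N
       + (15%:R * s 1%N ^+ 4 + 30%:R * s 1%N ^+ 2 * s 2%N
          + 5%:R * s 2%N ^+ 2 - 2%:R * s 4%N) / 48%:R * G 1%N
       + s 1%N * ((3%:R * s 1%N ^+ 4 + 10%:R * s 1%N ^+ 2 * s 2%N
          + 5%:R * s 2%N ^+ 2 - 2%:R * s 4%N) / 96%:R) * G 0%N
       + (63%:R * t 1%N ^+ 6 + 315%:R * t 1%N ^+ 4 * t 2%N
          + 315%:R * t 1%N ^+ 2 * t 2%N ^+ 2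
          - 126%:R * t 1%N ^+ 2 * t 4%N + 35%:R * t 2%N ^+ 3
          - 42%:R * t 2%N * t 4%N + 16%:R * t 6%N) / 378%:R
  /\ K 6%N = G 6%N + 3%:R * s 1%N * G 5%N
       + 5%:R / 4%:R * (3%:R * s 1%N ^+ 2 + s 2%N) * G 4%N
       + 5%:R / 2%:R * s 1%N * (s 1%N ^+ 2 + s 2%N) * G 3%N
       + (15%:R * s 1%N ^+ 4 + 30%:R * s 1%N ^+ 2 * s 2%N
          + 5%:R * s 2%N ^+ 2 - 2%:R * s 4%N) / 16%:R * G 2%N
       + s 1%N * ((3%:R * s 1%N ^+ 4 + 10%:R * s 1%N ^+ 2 * s 2%N
          + 5%:R * s 2%N ^+ 2 - 2%:R * s 4%N) / 16%:R) * G 1%N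
       + (63%:R * s 1%N ^+ 6 + 315%:R * s 1%N ^+ 4 * s 2%N
          + 315%:R * s 1%N ^+ 2 * s 2%N ^+ 2
          - 126%:R * s 1%N ^+ 2 * s 4%N + 35%:R * s 2%N ^+ 3
          - 42%:R * s 2%N * s 4%N + 16%:R * s 6%N) / 4032%:R * G 0%N
       + t 1%N * ((9%:R * t 1%N ^+ 6 + 63%:R * t 1%N ^+ 4 * t 2%N
          + 105%:R * t 1%N ^+ 2 * t 2%N ^+ 2
          - 42%:R * t 1%N ^+ 2 * t 4%N + 35%:R * t 2%N ^+ 3
          - 42%:R * t 2%N * t 4%N + 16%:R * t 6%N) / 63%:R).
Proof.
exists genus_coef, genera_const => m d m_ge2 [d_gt0 d_gcd _] K G s t.
have m_gt0 : (0 < m)%N by apply: ltnW.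
split=> [k X n mn|].
  have [N SN] := num_semigroup_cofinite d_gcd.
  rewrite alt_power_sumE // ?(leq_trans m_gt0) //.
  rewrite (exp_subst_hilbert_num SN _ mn) /K.
    by rewrite exprS; ring.
  apply: poly_hilbert_num => // M r rM; exact: coef_hilbert_num.
have sE j : s j = 2%:R ^+ j * t j + 1.
  by rewrite /t /delta /s mulrC divfK ?subrK // expf_neq0 ?pnatr_eq0.
(* The genus coefficients stay in the [sigma_k] and the constant term is rewritten in the [delta_k],
   so each displayed formula becomes a rational identity in independent quantities. *)
have KE p : K p =
    \sum_(r < p.+1) ('C(p, r) * (p - r)`!)%:R * todd s (p - r)%N * G r
    + p`!%:R * todd (fun k => 2%:R ^+ k * t k) p.+1.
  rewrite /K genera_combE; congr (_ + _ * todd _ _); apply/funext => j.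
  by rewrite -/s sE addrK.
do !split; rewrite KE !big_ord_recr big_ord0 /= /subn /=;
  rewrite ?(todd0n, todd1, todd2, todd3, todd4, todd5, todd6, todd7);
  by rewrite ?(bin0, binS, bin0n) ?factS ?fact0 /=; field.
Qed.
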